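(* There exists an infinite family of finite solvable CDGs $G_1, G_2, \dots$ such that, for every $i \geq 1$, $G_i$ has Fitting height $i+1$ and has a unique minimal normal subgroup. Furthermore, there exists an infinite family of finite solvable CDGs $G_1, G_2, \dots$ such that, for every $i \geq 1$, $G_i$ has Fitting height $i+1$, has a unique minimal normal subgroup, and has a Sylow tower.
   Context: All groups are finite. For a group $G$, $\mathrm{Irr}(G)$ is the set of irreducible complex characters of $G$ and $\mathrm{cd}(G) = \{\chi(1) \mid \chi \in \mathrm{Irr}(G)\}$. A group $G$ is a composite degree group (CDG) if $1$ is the only prime power lying in $\mathrm{cd}(G)$; here $1$ counts as a prime power, so the condition says that no element of $\mathrm{cd}(G)$ has the form $p^a$ with $p$ prime and $a \geq 1$. The Fitting height of a solvable group $G$ is the least $n$ with $F_n(G) = G$, where $F_0(G) = 1$ and $F_{i+1}(G)/F_i(G)$ is the Fitting subgroup of $G/F_i(G)$. A group $G$ has a Sylow tower if there is a chain $1 = N_0 \leq N_1 \leq \dots \leq N_n = G$ of normal subgroups of $G$ such that each $N_j/N_{j-1}$ is a Sylow $p_j$-subgroup of $G/N_{j-1}$, where $p_1, \dots, p_n$ are the distinct primes dividing $|G|$ in some order. *)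

(* Defs.v *)
From mathcomp Require Import all_boot all_order all_fingroup all_algebra.
From mathcomp Require Import all_solvable all_field all_character.

Set Implicit Arguments.
Unset Strict Implicit.
Unset Printing Implicit Defensive.

Import GroupScope.

Section CompositeDegreeGroups.

Variables (gT : finGroupType) (G : {group gT}).

Definition cd : seq algC := [seq ('chi[G]_i 1%g)%R | i : Iirr G].

(* The exponent is positive because the degree 1 is always attained, and is   *)
(* the one prime power that is allowed.                                       *)
Definition CDG : Prop :=
  forall p a : nat, prime p -> (0 < a)%N -> ((p ^ a)%N%:R)%R \notin cd.

Fixpoint Fitting_series (n : nat) : {group gT} :=
  if n is m.+1
  then (coset (Fitting_series m) @*^-1 'F(G / Fitting_series m))%G
  else 1%G.

Definition has_Fitting_height (n : nat) : Prop :=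
  Fitting_series n = G /\ (forall m, (m < n)%N -> Fitting_series m <> G).

(* minnormal M G only says that M is normalized by G, not that M lies in G.   *)
Definition has_unique_minimal_normal_subgroup : Prop :=
  exists! M : {group gT}, M \subset G /\ minnormal M G.

(* The primes p_1, ..., p_n are listed by ps, so that p_(j+1) is nth 0 ps j;  *)
(* the values of N beyond index size ps are irrelevant.                       *)
Definition has_Sylow_tower : Prop :=
  exists (ps : seq nat) (N : nat -> {group gT}),
    [/\ perm_eq ps (primes #|G|),
        N 0%N = 1%G,
        N (size ps) = G,
        forall j, (j <= size ps)%N -> N j <| G
      & forall j, (j < size ps)%N ->
          N j \subset N j.+1 /\
          (nth 0%N ps j).-Sylow(G / N j) (N j.+1 / N j)].

End CompositeDegreeGroups.

(* Main.v *)
(* Start from a group of prime order and raise the Fitting height by one at a *)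
(* time. Let G be a CDG with Fitting height n, a unique minimal normal        *)
(* subgroup M, and a Sylow tower. Choose distinct primes r, s, not dividing   *)
(* |G|, let X, Y be of order r, s, and put K = G x X x Y; then choose a prime *)
(* p not dividing |K|. In the regular module A of K over F_p the subgroup     *)
(* [A, M, X, Y] is nontrivial, so it contains a minimal K-invariant subgroup  *)
(* V; by coprimality none of M, X, Y centralizes V. Take H = V ><| K.         *)
(* - C_K(V) is normal in K and contains none of M, X, Y, so it is trivial and *)
(*   V is self-centralizing in H: V is the unique minimal normal subgroup of  *)
(*   H and V = F(H). As X x Y is central in K, H has Fitting height n + 1.    *)
(* - A character chi of H with V in its kernel is one of K, so chi(1) lies in *)
(*   cd(G). Otherwise chi lies over some lambda != 1 in Irr(V). For q = r, s  *)
(*   every Sylow q-subgroup P of H satisfies [V, P] = V, so that P cannot fix *)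
(*   lambda; hence rs divides the size of the orbit of lambda, and chi(1).    *)

(* Two distinct new primes r, s enter every new degree, so no prime power arises.
   [tower_CDG_extension] is the inductive step: [regular_module_commg] and
   [minnormal_noncentralized] supply [V], [CDG_sdprod] controls the degrees, [Fitting_minnormal] and
   the quotient lemmas for heights raise the height by exactly one, and [monolithic_minnormal] gives
   uniqueness. As |V|, r, s involve only new primes, [Hall_tower_sdprod] adds V, X, Y one after
   another at the bottom of the tower of G. *)
Require Import Defs.
From mathcomp Require Import all_boot all_order all_fingroup all_algebra.
From mathcomp Require Import all_solvable all_field all_character.
From Stdlib Require Import IndefiniteDescription.

Set Implicit Arguments.
Unset Strict Implicit.
Unset Printing Implicit Defensive.

Import GroupScope.

(** * The regular module *)

Lemma regular_module_delta {R : finComUnitRingType} {gT : finGroupType}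
    {G : {group gT}} (g x : gT) : g \in G -> x \in G ->
  (delta_mx (0 : 'I_1) (gring_index G g) *m regular_repr R G x =
   delta_mx 0 (gring_index G (g * x)%g))%R.
Proof. by move=> Gg Gx; rewrite -rowE rowK gring_indexK. Qed.

(* In the regular module the left-normed commutator [e_1, x, y, z] is the     *)
(* signed sum of the basis vectors e_w, with w ranging over the subproducts   *)
(* of x y z; only the empty subproduct contributes to the coefficient at 1.   *)
Lemma regular_module_commg (gT : finGroupType) (K : {group gT}) (p : nat) :
    prime p ->
  exists (hT : finGroupType) (A : {group hT}) (f : {morphism K >-> hT}),
    [/\ 'injm f, p.-abelem A, f @* K \subset 'N(A)
      & exists2 a, a \in A & forall x y z, x \in K -> y \in K -> z \in K ->
          1 \notin [:: x; y; z; x * y; x * z; y * z; x * y * z] ->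
          [~ a, f x, f y, f z] != 1].
Proof.
move=> p_pr; pose rG := regular_repr 'F_p K; pose to := ('MR rG)%gact.
exists (sdprod_by to), (sdpair1 to @* setT)%G, (sdpair2_morphism to).
split; first exact: injm_sdpair2.
- by rewrite morphim_abelem ?mx_Fp_abelem.
- exact: im_sdpair_norm.
exists (sdpair1 to (delta_mx 0 (gring_index K 1))%R) => [|x y z Kx Ky Kz]; first by rewrite mem_morphim ?inE.
(* Commutation with g acts on the module as g - 1, so the iterated commutator is e_1 (x - 1)(y -
   1)(z - 1). *)
have commE v g : g \in K ->
    [~ sdpair1 to v, sdpair2 to g] = sdpair1 to (v *m rG g - v)%R.
  move=> Kg; rewrite /commg -sdpair_act ?inE //= mx_repr_actE //.
  by rewrite -morphV ?inE // -morphM ?inE // FinRing.zmodMgE FinRing.zmodVgE GRing.addrC.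
rewrite !inE !negb_or => /and5P[x1 y1 z1 xy1 /and3P[xz1 yz1 xyz1]].
rewrite /= !commE // morph_injm_eq1 ?injm_sdpair1 ?inE //.
rewrite !(mulmxBl, regular_module_delta) ?groupM // !mul1g.
apply/eqP=> /matrixP/(_ 0 (gring_index K 1))%R.
have eqg g : g \in K -> 1 != g ->
    (gring_index K 1 == gring_index K g) = false.
  move=> Kg; apply: contraNF => /eqP/(congr1 (fun i => enum_val i)) /=.
  by rewrite !gring_indexK // => ->.
rewrite !mxE !eqxx /= !eqg ?groupM // ?eqxx /=.
rewrite !GRing.subr0 !GRing.sub0r !GRing.opprK  => /eqP.
by rewrite GRing.oppr_eq0 GRing.oner_eq0.
Qed.

(** * Character degrees *)

(** For a linear character lambda fixed by y, lambda(x^-1 x^y) = lambda(x)^-1 lambda(x) = 1. *)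
Lemma commg_inertia_cfker {gT : finGroupType} {V : {group gT}} (j : Iirr V)
    (P : {set gT}) : abelian V -> P \subset 'I[('chi_j)%R] ->
  [~: V, P] \subset cfker ('chi_j)%R.
Proof.
move=> abV sPI; have lin_j : ('chi_j)%R \is a linear_char by apply/char_abelianP.
rewrite gen_subG; apply/subsetP=> _ /imset2P[x y Vx /(subsetP sPI) Iy ->].
have nVy : y \in 'N(V) by case/setIdP: Iy.
rewrite -[gval _]/(cfker _) cfkerEirr inE /commg lin_charM ?groupV ?memJ_norm //.
by rewrite inertia_valJ // -lin_charM ?groupV // mulVg.
Qed.

(* By Clifford's theorem the index of the inertia group of a constituent of   *)
(* the restriction to V divides the degree.                                   *)
Lemma dvdn_irr1_Sylow_commg {gT : finGroupType} {H V : {group gT}} {q n : nat}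
    {i : Iirr H} :
    prime q -> V <| H -> abelian V ->
    (forall P : {group gT}, q.-Sylow(H) P -> V \subset [~: V, P]) ->
    ~~ (V \subset cfker ('chi_i)%R) -> ('chi_i)%R 1 = (n%:R)%R ->
  q %| n.
Proof.
move=> q_pr nsVH abV sylV kerV deg_i; have sVH := normal_sub nsVH.
have [j ij] := constt_cfRes_irr V i.
have nz_j : j != 0%R.
  by apply: contraNneq kerV => j0; rewrite constt0_Res_cfker // -j0.
have lin_j : ('chi_j)%R \is a linear_char by apply/char_abelianP.
have /Num.Theory.natrP[e def_e] : '['Res[V] 'chi_i, 'chi_j]%R \in Num.nat.
  by rewrite Cnat_cfdot_char ?cfRes_char ?irr_char.
have def_n : n = (e * #|H : 'I_H[('chi_j)%R]|)%N.
  apply/eqP; rewrite -(Num.Theory.eqr_nat algC) -deg_i -(cfRes1 V ('chi_i)%R).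
  rewrite (Clifford_Res_sum_cfclass nsVH ij) def_e cfunE sum_cfunE big_seq.
  rewrite (eq_bigr (fun _ => 1%R)) => [|_ /cfclassP[y _ ->]].
    rewrite -big_seq big_const_seq count_predT GRing.iter_addr_0 size_cfclass.
    by rewrite GRing.natrM.
  by rewrite cfConjg1 lin_char1.
(* If q did not divide the index, the inertia group would contain a full Sylow q-subgroup P of H,
   and V = [V, P] would lie in the kernel of the constituent. *)
rewrite def_n dvdn_mull //; apply: contraR nz_j => q'ind.
have [P sylP] := Sylow_exists q 'I_H[('chi_j)%R].
have [sPI qP q'IP] := and3P sylP.
have sylHP : q.-Sylow(H) P.
  rewrite /pHall (subset_trans sPI) ?subsetIl // qP.
  rewrite -(Lagrange_index (subsetIl H 'I[('chi_j)%R]) sPI) pnatM q'IP andbT.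
  by rewrite p'natE.
rewrite -subGcfker (subset_trans (sylV P sylHP)) // commg_inertia_cfker //.
exact: subset_trans sPI (subsetIr _ _).
Qed.

Lemma CDG_isog {gT rT : finGroupType} {G : {group gT}} {H : {group rT}} :
  G \isog H -> CDG G -> CDG H.
Proof.
rewrite isog_sym => /isogP[f injf fH] cdgG p a p_pr a_gt0.
have iso_f : isom H G f by apply/isomP.
apply: contra (cdgG p a p_pr a_gt0) => /mapP[i _ ->].
by apply/mapP; exists (isom_Iirr iso_f i); rewrite ?mem_enum // isom_IirrE cfIsom1.
Qed.

(** Irreducible characters of a direct product are products, and the factor on Z is linear. *)
Lemma CDG_dprod_abelian {gT : finGroupType} {G Z K : {group gT}} :
  G \x Z = K -> abelian Z -> CDG G -> CDG K.
Proof.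
move=> defK abZ cdgG p a p_pr a_gt0.
apply: contra (cdgG p a p_pr a_gt0) => /mapP[k _ ->]; apply/mapP.
rewrite -(inv_dprod_IirrK defK k); case: inv_dprod_Iirr => i j.
exists i; rewrite ?mem_enum // dprod_IirrE cfDprod1.
have lin_j : ('chi_j)%R \is a linear_char by apply/char_abelianP.
by rewrite (lin_char1 lin_j) GRing.mulr1.
Qed.

Lemma CDG_sdprod {gT : finGroupType} {V K H : {group gT}} {r s : nat} :
    V ><| K = H -> abelian V -> prime r -> prime s -> r != s ->
    (forall P : {group gT}, r.-Sylow(H) P -> V \subset [~: V, P]) ->
    (forall P : {group gT}, s.-Sylow(H) P -> V \subset [~: V, P]) ->
  CDG K -> CDG H.
Proof.
move=> defH abV r_pr s_pr neq_rs rV sV cdgK p a p_pr a_gt0.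
have [nsVH _ _ _ _] := sdprod_context defH.
apply/mapP=> [[i _ deg_i]].
have [kerV | kerV] := boolP (V \subset cfker ('chi_i)%R).
  case/mapP: (cdgK p a p_pr a_gt0); exists (Res_Iirr K i); rewrite ?mem_enum //.
  rewrite deg_i -{1}(sdprod_Res_IirrK defH kerV) sdprod_IirrE cfSdprod1.
  by [].
have r_p := dvdn_irr1_Sylow_commg r_pr nsVH abV rV kerV (esym deg_i).
have s_p := dvdn_irr1_Sylow_commg s_pr nsVH abV sV kerV (esym deg_i).
move: r_p s_p neq_rs; rewrite !Euclid_dvdX // a_gt0 !andbT !dvdn_prime2 //.
by move/eqP->; move/eqP->; rewrite eqxx.
Qed.

(** * Fitting height *)

Section FittingSeries.

Variables (gT : finGroupType) (G : {group gT}).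

Lemma Fitting_series_normal n : Fitting_series G n <| G.
Proof.
elim: n => [|n IHn] /=; first exact: normal1.
by rewrite -{2}(quotientGK IHn) cosetpre_normal Fitting_normal.
Qed.

Lemma Fitting_series_sub n : Fitting_series G n \subset Fitting_series G n.+1.
Proof. exact: sub_cosetpre. Qed.

Lemma quotient_Fitting_series n :
  Fitting_series G n.+1 / Fitting_series G n = 'F(G / Fitting_series G n).
Proof. exact: cosetpreK. Qed.

(** Recognizes the next term by its quotient, so that later proofs need not unfold the preimage
    under the coset map. *)
Lemma Fitting_seriesS_eq {n} {M B : {group gT}} :
    Fitting_series G n = M :> {set gT} -> M <| B -> B / M = 'F(G / M) ->
  Fitting_series G n.+1 = B :> {set gT}.
Proof. by move=> /group_inj <- nsMB /= <-; rewrite quotientGK. Qed.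

Lemma Fitting_series1 : Fitting_series G 1 = 'F(G) :> {set gT}.
Proof.
apply: (@Fitting_seriesS_eq 0 1%G 'F(G)%G); rewrite ?normal1 //=.
by rewrite /quotient injm_Fitting ?coset1_injm ?norms1.
Qed.

End FittingSeries.

Lemma injm_Fitting_series {gT rT : finGroupType} {G : {group gT}}
    {f : {morphism G >-> rT}} n : 'injm f ->
  f @* Fitting_series G n = Fitting_series (f @* G)%G n :> {set rT}.
Proof.
move=> injf; elim: n => [|n IHn]; first by rewrite morphim1.
have nsMG := Fitting_series_normal G n; have nsBG := Fitting_series_normal G n.+1.
apply/esym/(Fitting_seriesS_eq (M := (f @* Fitting_series G n)%G)) => //.
  apply: morphim_normal; apply: normalS (Fitting_series_sub G n) _ nsMG.
  exact: normal_sub nsBG.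
rewrite /= -(morphim_quotm f nsMG) quotient_Fitting_series.
by rewrite -(morphim_quotm f nsMG) injm_Fitting ?injm_quotm.
Qed.

Lemma has_Fitting_height_isog {gT rT : finGroupType} {G : {group gT}}
    {H : {group rT}} {n} :
  G \isog H -> has_Fitting_height G n -> has_Fitting_height H n.
Proof.
case/isogP=> f injf fG [topG lowG].
have eqH : H = (f @* G)%G by exact: group_inj.
split=> [|m ltmn].
  by apply: group_inj; rewrite eqH -injm_Fitting_series // topG.
move/(congr1 val) => /=; rewrite eqH -injm_Fitting_series // => fmG.
apply: (lowG m ltmn); apply: group_inj; apply: (injm_morphim_inj injf) => //.
exact: normal_sub (Fitting_series_normal G m).
Qed.

(* In the applications (a, b) is (1, 0) for N the Fitting subgroup of G, and  *)
(* (1, 1) for N central.                                                      *)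
Section FittingHeightQuotient.

Variables (gT : finGroupType) (G N : {group gT}) (a b : nat).
Hypotheses (nsNG : N <| G) (sNFa : N \subset Fitting_series G a).
Hypothesis eq_ab :
  Fitting_series G a / N = Fitting_series (G / N)%G b :> {set coset_of N}.

(** The third isomorphism (G / N) / (A / N) = G / A matches the Fitting subgroups, so agreement at
    one index propagates upwards. *)
Lemma quotient_Fitting_seriesD n :
  N \subset Fitting_series G (a + n) /\
  Fitting_series G (a + n) / N = Fitting_series (G / N)%G (b + n)
    :> {set coset_of N}.
Proof.
elim: n => [|n [sNA eqA]]; first by rewrite !addn0.
rewrite !addnS; set A := Fitting_series G _ in sNA eqA *.
set B := Fitting_series G _.+1; have sAB : A \subset B := Fitting_series_sub G _.
have [nsAG nsBG] : A <| G /\ B <| G by split; apply: Fitting_series_normal.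
have nsAB : A <| B := normalS sAB (normal_sub nsBG) nsAG.
split; first exact: subset_trans sNA sAB.
apply/esym/(Fitting_seriesS_eq (M := (A / N)%G)) => //=; first exact: quotient_normal.
have [f injf im_f] := third_isom sNA nsNG nsAG.
apply: (injm_morphim_inj injf); rewrite ?Fitting_sub ?quotientS ?normal_sub //.
by rewrite injm_Fitting // !im_f ?normal_sub // quotient_Fitting_series.
Qed.

Lemma Fitting_series_eq_quotient n :
  (Fitting_series G (a + n) = G) <-> (Fitting_series (G / N)%G (b + n) = G / N)%G.
Proof.
have [sNA eqA] := quotient_Fitting_seriesD n.
have nsNA := normalS sNA (normal_sub (Fitting_series_normal G _)) nsNG.
split=> [eqG | /(congr1 val) /= eqG].
  by apply: group_inj; rewrite -eqA eqG.
by apply: group_inj; apply: quotient_inj nsNA nsNG _; rewrite eqA.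
Qed.

End FittingHeightQuotient.

(** Passing to G / F(G) shifts the series by one; G != 1 excludes height 0. *)
Lemma has_Fitting_height_Fitting_quotient {gT : finGroupType} {G : {group gT}} {n} :
    G :!=: 1 -> has_Fitting_height (G / 'F(G))%G n ->
  has_Fitting_height G n.+1.
Proof.
move=> ntG [topG lowG].
have eqF m := Fitting_series_eq_quotient (Fitting_normal G)
  (a := 1) (b := 0) _ _ m.
have {}eqF m : (Fitting_series G m.+1 = G) <->
    (Fitting_series (G / 'F(G))%G m = G / 'F(G))%G.
  by apply: eqF; rewrite Fitting_series1 // trivg_quotient.
split=> [|[|m] ltmn]; first exact/eqF.
  by move/(congr1 val) => /= G1; rewrite -G1 eqxx in ntG.
by move/eqF; apply: lowG.
Qed.

(** The preimage B of F(G / Z) is a central extension of a nilpotent group, hence nilpotent and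
    inside F(G). *)
Lemma quotient_central_Fitting {gT : finGroupType} {G Z : {group gT}} :
  Z \subset 'Z(G) -> 'F(G / Z) = 'F(G) / Z.
Proof.
move=> sZZ; have nsZG : Z <| G := sub_center_normal sZZ.
have nsZF : Z <| 'F(G).
  rewrite (normalS _ (Fitting_sub G)) // Fitting_max //.
  exact: abelian_nil (abelianS sZZ (center_abelian G)).
apply/eqP; rewrite eqEsubset andbC Fitting_max ?quotient_normal ?Fitting_normal //=;
  last by rewrite quotient_nil ?Fitting_nil.
have [B defB sZB nsBG] := inv_quotientN nsZG (Fitting_normal (G / Z)).
have sBG := normal_sub nsBG.
rewrite defB quotientS // Fitting_max //.
have sZZB : Z \subset 'Z(B).
  rewrite subsetI sZB (subset_trans sZZ) //.
  by rewrite (subset_trans (subsetIr _ _)) ?centS.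
have nsZB := sub_center_normal sZZB.
rewrite -quotient_center_nil -(isog_nil (third_isog sZZB nsZB (center_normal B))).
by rewrite quotient_nil //= -defB Fitting_nil.
Qed.

(** The two series correspond from index 1 on. The height must be positive: for G = Z the quotient
    has height 0. *)
Lemma has_Fitting_height_central_quotient {gT : finGroupType} {G Z : {group gT}} {n} :
    Z \subset 'Z(G) -> has_Fitting_height (G / Z)%G n.+1 ->
  has_Fitting_height G n.+1.
Proof.
move=> sZZ [topG lowG]; have nsZG : Z <| G := sub_center_normal sZZ.
have eqF m : (Fitting_series G m.+1 = G) <->
    (Fitting_series (G / Z)%G m.+1 = G / Z)%G.
  apply: (Fitting_series_eq_quotient nsZG (a := 1) (b := 1) _ _ m).
    rewrite Fitting_series1 Fitting_max //.
    exact: abelian_nil (abelianS sZZ (center_abelian G)).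
  by rewrite !Fitting_series1 -quotient_central_Fitting.
split=> [|[|m] ltmn]; first exact/eqF.
  move/(congr1 val) => /= G1; apply: (lowG 0 isT); apply: group_inj.
  by rewrite /= -G1 quotient1.
by move/eqF; apply: lowG.
Qed.

(** * Sylow towers *)

Definition prime_prefix (ps : seq nat) (j : nat) : nat_pred :=
  [pred q in take j ps].

(** A form of Sylow tower free of quotients, hence easy to transport and to extend at the bottom. *)
Definition Hall_tower (gT : finGroupType) (G : {group gT}) (ps : seq nat) :=
  perm_eq ps (primes #|G|) /\
  forall j, exists2 N : {group gT}, N <| G & (prime_prefix ps j).-Hall(G) N.

Lemma Hall_tower_has_Sylow_tower (gT : finGroupType) (G : {group gT}) ps :
  Hall_tower G ps -> has_Sylow_tower G.
Proof.
(* A normal Hall pi-subgroup is O_pi(G); this canonical choice makes the chain increasing. *)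
case=> eq_ps hallG; pose N j := 'O_(prime_prefix ps j)(G)%G.
have nsNG j : N j <| G by apply: pcore_normal.
have hallN j : (prime_prefix ps j).-Hall(G) (N j).
  by have [M nsMG hallM] := hallG j; rewrite /= (normal_Hall_pcore hallM nsMG).
exists ps, N; split=> // [||j lt_j].
(* For the empty prefix the order of N 0 is coprime to itself. *)
- apply: group_inj; rewrite -[LHS]setIid coprime_TIg //.
  apply: (@pnat_coprime (prime_prefix ps 0)); first exact: pcore_pgroup.
  by apply: sub_in_pnat (pcore_pgroup _ G) => q _; rewrite !inE take0.
- apply: group_inj; apply: pcore_pgroup_id.
  rewrite /pgroup /prime_prefix take_size /pnat cardG_gt0; apply/allP=> q.
  by rewrite inE /= (perm_mem eq_ps).
have prefixS q : (q \in prime_prefix ps j.+1) =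
    (q \in prime_prefix ps j) || (q == nth 0 ps j).
  by rewrite !inE (take_nth 0) // mem_rcons inE orbC.
split; first by apply: sub_pcore => q; rewrite prefixS => ->.
(* The first j primes do not divide |G / N j|, so there the longer prefix amounts to its last
   prime. *)
rewrite -(@eq_in_pHall _ (prime_prefix ps j.+1)).
  apply: quotient_pHall (hallN _).
  by rewrite (subset_trans (pcore_sub _ _)) ?normal_norm.
move=> q; rewrite mem_primes => /and3P[q_pr _ q_dv]; rewrite prefixS inE.
suffices /negbTE-> : q \notin prime_prefix ps j by [].
have /and3P[_ _] := hallN j; rewrite -card_quotient ?normal_norm // => /pnatP.
by apply=> //; apply: cardG_gt0.
Qed.

Lemma Hall_tower_isog (gT rT : finGroupType) (G : {group gT}) (H : {group rT}) ps :
  G \isog H -> Hall_tower G ps -> Hall_tower H ps.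
Proof.
move=> isoGH [eq_ps hallG]; split; first by rewrite -(card_isog isoGH).
case/isogP: isoGH => f injf fG j; have [N nsNG hallN] := hallG j.
have sNG := normal_sub nsNG.
exists (f @* N)%G; rewrite -fG ?morphim_normal //.
by rewrite injm_pHall.
Qed.

Lemma Hall_tower1 (gT : finGroupType) : Hall_tower [1 gT] [::].
Proof.
split=> [|j]; first by rewrite cards1.
by exists 1%G; rewrite ?normal1 // pHallE subxx cards1 part_pnat_id.
Qed.

Lemma Hall_tower_sdprod (gT : finGroupType) (P K G : {group gT}) p ps :
    P ><| K = G -> prime p -> p.-group P -> P :!=: 1 -> p^'.-group K ->
  Hall_tower K ps -> Hall_tower G (p :: ps).
Proof.
move=> defG p_pr pP ntP p'K [eq_ps hallK].
have [nsPG sKG mulPK nPK tiPK] := sdprod_context defG.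
have oG := sdprod_card defG.
have mem_ps q : (q \in ps) = (q \in primes #|K|) := perm_mem eq_ps q.
have ps'p : p \notin ps by rewrite mem_ps -p'natEpi.
split.
  apply: uniq_perm; rewrite ?primes_uniq //= ?ps'p.
    by rewrite (perm_uniq eq_ps) primes_uniq.
  move=> q; rewrite inE -oG primesM // mem_ps; congr (_ || _).
  have [_ p_dv [m oP]] := pgroup_pdiv pP ntP.
  by rewrite oP primesX // primes_prime // inE.
case=> [|j].
  exists 1%G; rewrite ?normal1 // /pHall /pgroup sub1G cards1 indexg1 /= /pnat cardG_gt0.
  by apply/allP=> q; rewrite !inE.
have [N nsNK hallN] := hallK j; have [sNK nNK] := andP nsNK.
have [_ piN pi'N] := and3P hallN.
have tiPN : P :&: N = 1 by apply/trivgP; rewrite -tiPK setIS.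
have nPN := subset_trans sNK nPK.
have defPN : P <*> N = P * N by rewrite norm_joinEr.
have sPN_G : P <*> N \subset G by rewrite join_subG normal_sub // (subset_trans sNK).
have oPN : #|P <*> N| = (#|P| * #|N|)%N by rewrite defPN TI_cardMg.
exists (P <*> N)%G.
  rewrite /normal sPN_G -mulPK mulG_subG (subset_trans (joing_subl P N)) ?normG //=.
  by rewrite normsY.
rewrite /pHall sPN_G /pgroup oPN pnatM -divgS //= oPN -oG divnMl //.
rewrite divgS // -andbA; apply/and3P; split.
- by apply: sub_in_pnat pP => q _ /[!inE]/= ->.
- by apply: sub_in_pnat piN => q _; rewrite !inE orbC => ->.
apply: sub_in_pnat pi'N => q /= q_dv; rewrite !inE negb_or andbC => ->.
apply: contraNneq ps'p => <-; rewrite mem_ps.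
move: q_dv; rewrite !mem_primes => /and3P[-> _ q_dv]; rewrite cardG_gt0 /=.
exact: dvdn_trans q_dv (dvdn_indexg _ _).
Qed.

(** * Unique minimal normal subgroups *)

(** The monolith as the least nontrivial normal subgroup. *)
Definition monolithic (gT : finGroupType) (G : {group gT}) :=
  exists M : {group gT}, [/\ M <| G, M :!=: 1
    & forall N : {group gT}, N <| G -> N :!=: 1 -> M \subset N].

Lemma monolithic_unique_minimal_normal (gT : finGroupType) (G : {group gT}) :
  monolithic G -> has_unique_minimal_normal_subgroup G.
Proof.
case=> M [/andP[sMG nMG] ntM minM]; exists M; split.
  split=> //; apply/mingroupP; split=> [|N /andP[ntN nNG] sNM].
    by rewrite ntM.
  by apply/eqP; rewrite eqEsubset sNM minM // /normal (subset_trans sNM).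
move=> N [sNG /mingroupP[/andP[ntN nNG] minN]].
have sMN : M \subset N by rewrite minM // /normal sNG.
by apply/group_inj/minN; rewrite ?ntM.
Qed.

Lemma monolithic_isog (gT rT : finGroupType) (G : {group gT}) (H : {group rT}) :
  G \isog H -> monolithic G -> monolithic H.
Proof.
case/isogP=> f injf fG [M [nsMG ntM minM]]; exists (f @* M)%G.
have sMG := normal_sub nsMG; split=> [||N nsNH ntN].
- by rewrite -fG morphim_normal.
- by rewrite morphim_injm_eq1.
have sNfG : N \subset f @* G by rewrite fG normal_sub.
rewrite -(morphpreK sNfG) morphimS // minM //.
  by rewrite -{2}(injmK injf (subxx G)) fG morphpre_normal // fG.
apply: contraNneq ntN => N1; rewrite -(morphpreK sNfG).
by have /= -> := N1; rewrite morphim1.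
Qed.

(** A normal N meeting V trivially centralizes V, so it lies in V and is trivial. *)
Lemma monolithic_minnormal (gT : finGroupType) (V H : {group gT}) :
    V <| H -> minnormal V H -> 'C_H(V) \subset V -> monolithic H.
Proof.
move=> nsVH /mingroupP[/andP[ntV nVH] minV] sCV; exists V; split=> // N nsNH ntN.
have [sVH _] := andP nsVH; have [sNH nNH] := andP nsNH.
have [VN1 | ntVN] := eqVneq (V :&: N) 1; last first.
  by rewrite -(minV (V :&: N)%G) ?subsetIl ?subsetIr //= ntVN normsI.
case/negP: ntN; rewrite -subG1 -VN1 subsetI subxx andbT.
rewrite (subset_trans _ sCV) // subsetI sNH.
have nVN := subset_trans sNH nVH; have nNV := subset_trans sVH nNH.
by apply/commG1P/trivgP; rewrite -VN1 subsetI commg_subl commg_subr nVN nNV.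
Qed.

(** V meets the center of the nilpotent group F(H), so by minimality it lies there; then F(H)
    centralizes V. *)
Lemma Fitting_minnormal (gT : finGroupType) (V H : {group gT}) :
    V <| H -> abelian V -> minnormal V H -> 'C_H(V) \subset V -> 'F(H) = V.
Proof.
move=> nsVH abV /mingroupP[/andP[ntV nVH] minV] sCV.
have sVF : V \subset 'F(H) by rewrite Fitting_max ?abelian_nil.
apply/eqP; rewrite eqEsubset sVF andbT (subset_trans _ sCV) //.
rewrite subsetI Fitting_sub centsC.
have nsVF : V <| 'F(H) := normalS sVF (Fitting_sub H) nsVH.
have ntVZ := meet_center_nil (Fitting_nil H) nsVF ntV.
have <-: V :&: 'Z('F(H)) = V.
  by apply: minV; rewrite ?subsetIl //= ntVZ normsI // !gFnorm_trans.
by rewrite (subset_trans (subsetIr _ _)) ?subsetIr.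
Qed.

(** * Raising the Fitting height *)

(** Take V inside [A, X, Y, Z], which lies in [A, W] for each of the three subgroups W; by coprime
    action on the abelian group A, W has no nontrivial fixed point in [A, W]. *)
Lemma minnormal_noncentralized (gT : finGroupType) (A K X Y Z : {group gT}) :
    abelian A -> K \subset 'N(A) -> coprime #|A| #|K| ->
    X <| K -> Y <| K -> Z <| K -> [~: A, X, Y, Z] != 1 ->
  exists V : {group gT}, [/\ V \subset A, minnormal V K,
    ~~ (X \subset 'C(V)), ~~ (Y \subset 'C(V)) & ~~ (Z \subset 'C(V))].
Proof.
move=> abA nAK coAK nsXK nsYK nsZK ntU.
have nAS (W : {group gT}) : W <| K -> W \subset 'N(A).
  by move=> nsWK; rewrite (subset_trans (normal_sub nsWK)).
have nKR (B W : {group gT}) : K \subset 'N(B) -> W <| K -> K \subset 'N([~: B, W]).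
  by move=> nBK nsWK; apply: normsR nBK (normal_norm nsWK).
have nAX := nKR _ _ nAK nsXK; have nAXY := nKR [~: A, X]%G _ nAX nsYK.
have nAXYZ := nKR [~: A, X, Y]%G _ nAXY nsZK.
have [V minV sVU] := minnormal_exists ntU nAXYZ.
have /mingroupP[/andP[ntV _] _] := minV.
have subR (B W : {group gT}) : K \subset 'N(B) -> W <| K -> [~: B, W] \subset B.
  by move=> nBK nsWK; rewrite commg_subl (subset_trans (normal_sub nsWK)).
have sXA := subR _ _ nAK nsXK; have sYX := subR [~: A, X]%G _ nAX nsYK.
have sZY := subR [~: A, X, Y]%G _ nAXY nsZK.
have ncent (W : {group gT}) : W <| K -> V \subset [~: A, W] -> ~~ (W \subset 'C(V)).
  move=> nsWK sVAW; apply: contra ntV; rewrite centsC -subG1 => cVW.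
  rewrite -(coprime_abel_cent_TI (nAS W nsWK) _ abA) ?subsetI ?sVAW //.
  exact: coprimegS (normal_sub nsWK) coAK.
exists V; split=> //.
- exact: subset_trans sVU (subset_trans sZY (subset_trans sYX sXA)).
- exact: ncent nsXK (subset_trans sVU (subset_trans sZY sYX)).
- apply: ncent nsYK (subset_trans sVU (subset_trans sZY _)).
  exact: commSg.
apply: ncent nsZK (subset_trans sVU _); apply: commSg.
exact: subset_trans sYX sXA.
Qed.

(** [V, X] is K-invariant and nontrivial, hence V. As V is a q'-group, X is Sylow in H, and the
    other Sylow subgroups are its conjugates. *)
Lemma minnormal_sub_commg_Sylow (gT : finGroupType) (V K H X : {group gT}) (q : nat) :
    V ><| K = H -> abelian V -> minnormal V K -> q^'.-group V ->
    X <| K -> q.-Sylow(K) X -> ~~ (X \subset 'C(V)) ->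
  forall P : {group gT}, q.-Sylow(H) P -> V \subset [~: V, P].
Proof.
move=> defH abV /mingroupP[/andP[ntV nVK] minV] q'V nsXK sylX ncVX P sylP.
have [nsVH sKH mulVK _ tiVK] := sdprod_context defH.
have [sXK nXK] := andP nsXK; have [_ qX q'KX] := and3P sylX.
have sylHX : q.-Sylow(H) X.
  rewrite /pHall (subset_trans sXK) // qX -(Lagrange_index sKH sXK).
  rewrite pnatM q'KX andbT (_ : #|H : K| = #|V|) //.
  by rewrite -divgS // -(sdprod_card defH) mulnK.
have defV : [~: V, X] = V.
  apply: minV; last by rewrite commg_subl (subset_trans sXK).
  by rewrite normsR // andbT; apply: contra ncVX => /eqP/commG1P; rewrite centsC.
have [h Hh ->] := Sylow_trans sylHX sylP.
have nVh : V :^ h = V by apply: (normsP (normal_norm nsVH)).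
by rewrite -{2}nVh -conjsRg defV nVh.
Qed.

(** |W| |N| = |WN| divides |K|, so |N| divides |K : W|. *)
Lemma coprime_Hall_TI (gT : finGroupType) (K W N : {group gT}) :
    W <| K -> coprime #|W| #|K : W| -> N \subset K -> W :&: N = 1 ->
  coprime #|W| #|N|.
Proof.
move=> nsWK coW sNK tiWN; apply: coprime_dvdr coW.
have [sWK nWK] := andP nsWK.
rewrite -(@dvdn_pmul2l #|W|) // Lagrange // -TI_cardMg //.
have nWN := subset_trans sNK nWK.
by rewrite -norm_joinEr // cardSg // join_subG sWK.
Qed.

Definition tower_CDG (gT : finGroupType) (G : {group gT}) (n : nat) :=
  [/\ solvable G, CDG G, has_Fitting_height G n, monolithic G
    & exists ps, Hall_tower G ps].

Lemma tower_CDG_isog (gT rT : finGroupType) (G : {group gT}) (H : {group rT}) n :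
  G \isog H -> tower_CDG G n -> tower_CDG H n.
Proof.
move=> isoGH [solG cdgG htG monG [ps towG]]; split.
- by rewrite -(isog_sol isoGH).
- exact: CDG_isog isoGH cdgG.
- exact: has_Fitting_height_isog isoGH htG.
- exact: monolithic_isog isoGH monG.
by exists ps; apply: Hall_tower_isog isoGH towG.
Qed.

Lemma tower_CDG_extension (gT : finGroupType) (A G X Y K : {group gT}) p n :
    prime p -> p.-abelem A -> K \subset 'N(A) -> p^'.-group K ->
    G \x (X \x Y) = K -> prime #|X| -> prime #|Y| -> #|X| != #|Y| ->
    coprime #|G| #|X| -> coprime #|G| #|Y| ->
    (exists2 a, a \in A & forall x y z, x \in K -> y \in K -> z \in K ->
       1 \notin [:: x; y; z; x * y; x * z; y * z; x * y * z] ->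
       [~ a, x, y, z] != 1) ->
    tower_CDG G n.+1 ->
  exists H : {group gT}, tower_CDG H n.+2.
Proof.
move=> p_pr abelA nAK p'K defK prX prY neqXY coGX coGY commA goodG.
have [solG cdgG htG [M [nsMG ntM minM]] [ps towG]] := goodG.
have [[G1 Z _ defZ] mulGZ cGZ tiGZ] := dprodP defK.
have [_ mulXY cXY tiXY] := dprodP defZ.
rewrite defZ in defK mulGZ cGZ tiGZ.
have [nsGK nsZK] := dprod_normal2 defK; have [nsXZ nsYZ] := dprod_normal2 defZ.
have oZ := dprod_card defZ; have oK := dprod_card defK.
have [sGK sZK] := (normal_sub nsGK, normal_sub nsZK).
have [sXZ sYZ] := (normal_sub nsXZ, normal_sub nsYZ).
have abZ : abelian Z.
  by rewrite -mulXY abelianM !cyclic_abelian ?prime_cyclic.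
have cKZ : Z \subset 'Z(K).
  by rewrite subsetI sZK -mulGZ centM subsetI cGZ.
have coXY : coprime #|X| #|Y| by rewrite prime_coprime // dvdn_prime2.
have nsXK : X <| K := sub_center_normal (subset_trans sXZ cKZ).
have nsYK : Y <| K := sub_center_normal (subset_trans sYZ cKZ).
have [sXK sYK] := (normal_sub nsXK, normal_sub nsYK).
have nsMK : M <| K.
  have [sMG nMG] := andP nsMG; rewrite /normal (subset_trans sMG) //= -mulGZ.
  by rewrite mulG_subG nMG cents_norm // centsC (subset_trans sMG) // centsC.
(* Nontrivial x, y, z in the independent factors M, X, Y have no trivial nonempty subproduct. *)
have ntU : [~: A, M, X, Y] != 1.
  have [a Aa comm_a] := commA.
  have [x Mx ntx] := trivgPn _ ntM.
  have [y Xy nty] : exists2 y, y \in X & y != 1.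
    by apply/trivgPn; rewrite -cardG_gt1 prime_gt1.
  have [z Yz ntz] : exists2 z, z \in Y & z != 1.
    by apply/trivgPn; rewrite -cardG_gt1 prime_gt1.
  have Gx := subsetP (normal_sub nsMG) x Mx.
  have TI1 (B C : {group gT}) b c : B :&: C = 1 -> b \in B -> c \in C ->
      b != 1 -> 1 != b * c.
    move=> tiBC Bb Cc; apply: contraNneq => bc1; apply/eqP/set1gP.
    rewrite -tiBC inE Bb.
    by rewrite -groupV (_ : b^-1 = c) // -[c](mulKg b) -bc1 mulg1.
  have [Zy Zz] := (subsetP sXZ y Xy, subsetP sYZ z Yz).
  have: [~ a, x, y, z] != 1.
    apply: comm_a; rewrite ?(subsetP sGK x) ?(subsetP sXK y) ?(subsetP sYK z) //.
    rewrite !inE !negb_or (eq_sym 1 x) (eq_sym 1 y) (eq_sym 1 z) ntx nty ntz /=.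
    rewrite -mulgA (TI1 _ _ x y tiGZ) // (TI1 _ _ x z tiGZ) //.
    by rewrite (TI1 _ _ y z tiXY) // (TI1 _ _ x (y * z) tiGZ) ?groupM.
  by apply: contraNneq => U1; apply/eqP/set1gP; rewrite -U1 !mem_commg.
have coAK : coprime #|A| #|K|.
  exact: pnat_coprime (abelem_pgroup abelA) p'K.
have [V [sVA minV ncM ncX ncY]] :=
  minnormal_noncentralized (abelem_abelian abelA) nAK coAK nsMK nsXK nsYK ntU.
have /mingroupP[/andP[ntV nVK] minVK] := minV.
have pV := pgroupS sVA (abelem_pgroup abelA).
have abV := abelianS sVA (abelem_abelian abelA).
have tiVK : V :&: K = 1 by rewrite (coprime_TIg (coprimeSg sVA coAK)).
have defH : V ><| K = V <*> K by rewrite sdprodEY.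
exists (V <*> K)%G; set H := (V <*> K)%G in defH *.
have [nsVH sKH mulVK _ _] := sdprod_context defH.
have minVH : minnormal V H.
  apply/mingroupP; split=> [|W /andP[ntW nWH] sWV]; first by rewrite ntV normal_norm.
  by apply: minVK; rewrite ?ntW ?(subset_trans sKH).
(* G, X and Y are normal Hall subgroups of K meeting the centralizer trivially: X and Y have prime
   order, and a nontrivial intersection with G would contain M. So its order is coprime to |K|. *)
have CK1 : 'C_K(V) = 1.
  have nsCK : 'C_K(V) <| K by rewrite /normal subsetIl normsI ?normG ?norms_cent.
  have sCK := normal_sub nsCK.
  have coX : coprime #|X| #|'C_K(V)|.
    apply: (coprime_Hall_TI nsXK _ sCK).
      rewrite -divgS // -oK -oZ mulnCA mulKn ?cardG_gt0 //.
      by rewrite coprimeMr coXY coprime_sym coGX.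
    by rewrite prime_TIg // subsetI sXK.
  have coY : coprime #|Y| #|'C_K(V)|.
    apply: (coprime_Hall_TI nsYK _ sCK).
      rewrite -divgS // -oK -oZ mulnA mulnK ?cardG_gt0 //.
      by rewrite coprimeMr coprime_sym coGY coprime_sym.
    by rewrite prime_TIg // subsetI sYK.
  have coG : coprime #|G| #|'C_K(V)|.
    apply: (coprime_Hall_TI nsGK _ sCK).
      by rewrite -divgS // -oK -oZ mulKn ?cardG_gt0 // coprimeMr coGX.
    apply: contraNeq ncM => ntGC.
    rewrite (subset_trans (minM (G :&: 'C_K(V))%G _ _)) //.
      rewrite /normal subsetIl normsI ?normG //.
      by rewrite (subset_trans sGK) ?normal_norm.
    by rewrite /= setIA subsetIr.
  rewrite -(setIidPr sCK) coprime_TIg //.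
  by rewrite -oK -oZ !coprimeMl coG coX.
have sCV : 'C_H(V) \subset V.
  by rewrite /= -mulVK -group_modl // CK1 mulg1.
have defF := Fitting_minnormal nsVH abV minVH sCV.
have q'V q : prime q -> q %| #|K| -> q^'.-group V.
  move=> q_pr q_dv; apply: sub_in_pnat pV => _ _ /eqnP->; rewrite !inE.
  by apply: contraL q_dv => /eqP<-; rewrite -p'natE.
have sylX : #|X|.-Sylow(K) X.
  rewrite /pHall sXK /pgroup pnat_id // p'natE // -divgS // -oK -oZ mulnCA.
  rewrite mulKn ?cardG_gt0 // -prime_coprime // coprimeMr coXY.
  by rewrite coprime_sym coGX.
have sylY : #|Y|.-Sylow(K) Y.
  rewrite /pHall sYK /pgroup pnat_id // p'natE // -divgS // -oK -oZ mulnA.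
  rewrite mulnK ?cardG_gt0 // -prime_coprime // coprimeMr coprime_sym coGY.
  by rewrite coprime_sym.
have isoKZ : G \isog K / Z by apply: sdprod_isog (dprodWsdC defK).
have solK : solvable K.
  by rewrite (series_sol nsZK) abelian_sol // -(isog_sol isoKZ).
have q'VX := q'V _ prX (cardSg sXK); have q'VY := q'V _ prY (cardSg sYK).
split.
- rewrite (series_sol nsVH) abelian_sol //.
  by rewrite -(isog_sol (sdprod_isog defH)).
- apply: (CDG_sdprod defH abV prX prY neqXY _ _ (CDG_dprod_abelian defK abZ cdgG)).
    exact: minnormal_sub_commg_Sylow defH abV minV q'VX nsXK sylX ncX.
  exact: minnormal_sub_commg_Sylow defH abV minV q'VY nsYK sylY ncY.
(* H / F(H) = H / V is isomorphic to K, and K modulo its central subgroup Z to G. *)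
- apply: has_Fitting_height_Fitting_quotient.
    by rewrite trivg_card1 -(sdprod_card defH) muln_eq1 -trivg_card1 (negPf ntV).
  have -> : 'F(H)%G = V by apply: group_inj.
  apply: has_Fitting_height_isog (sdprod_isog defH) _.
  apply: has_Fitting_height_central_quotient cKZ _.
  exact: has_Fitting_height_isog isoKZ htG.
- exact: monolithic_minnormal nsVH minVH sCV.
have defYG : Y \x G = Y <*> G.
  apply: dprodEY; first by rewrite centsC (subset_trans sYZ) // centsC.
  by rewrite setIC; apply/trivgP; rewrite -tiGZ setIS.
have defXYG : X ><| (Y <*> G) = K.
  by apply: dprodWsd; rewrite -defYG dprodA defZ dprodC.
have towYG : Hall_tower (Y <*> G)%G (#|Y| :: ps).
  apply: (Hall_tower_sdprod (dprodWsd defYG) prY _ _ _ towG).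
  - by rewrite /pgroup pnat_id.
  - by rewrite -cardG_gt1 prime_gt1.
  by rewrite /pgroup p'natE // -prime_coprime // coprime_sym.
have towK : Hall_tower K (#|X| :: #|Y| :: ps).
  apply: (Hall_tower_sdprod defXYG prX _ _ _ towYG).
  - by rewrite /pgroup pnat_id.
  - by rewrite -cardG_gt1 prime_gt1.
  rewrite /pgroup p'natE // -prime_coprime // -(dprod_card defYG) coprimeMr coXY.
  by rewrite coprime_sym.
exists [:: p, #|X|, #|Y| & ps].
exact: Hall_tower_sdprod defH p_pr pV ntV p'K towK.
Qed.

(** The bounds matter because ['Z_r] has order r only for r > 1. *)
Lemma tower_CDG_dprod_primes (gT : finGroupType) (G : {group gT}) r s :
    1 < r -> 1 < s ->
  exists (kT : finGroupType) (G' X Y K : {group kT}),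
    [/\ G \isog G', G' \x (X \x Y) = K, #|X| = r & #|Y| = s].
Proof.
move=> r_gt1 s_gt1; pose zT : finGroupType := ('Z_r * 'Z_s)%type.
pose X0 := setX_group [set: 'Z_r]%G [1 'Z_s]%G.
pose Y0 := setX_group [1 'Z_r]%G [set: 'Z_s]%G.
have defZ0 : X0 \x Y0 = [set: zT] by rewrite setX_dprod; apply/setP=> u; rewrite !inE.
exists (gT * zT)%type, (@pairg1 gT zT @* G)%G, (@pair1g gT zT @* X0)%G,
  (@pair1g gT zT @* Y0)%G, (setX_group G [set: zT]%G); split.
- by rewrite sub_isog ?subsetT ?injm_pairg1.
- by rewrite (injm_dprod _ _ defZ0) ?injm_pair1g ?subsetT //=
    morphim_pairg1 morphim_pair1g setX_dprod.
- by rewrite card_injm ?injm_pair1g ?subsetT // cardsX cards1 cardsT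
    card_ord Zp_cast // muln1.
by rewrite card_injm ?injm_pair1g ?subsetT // cardsX cards1 cardsT
    card_ord Zp_cast // mul1n.
Qed.

Lemma tower_CDG_succ (gT : finGroupType) (G : {group gT}) n :
    tower_CDG G n.+1 ->
  exists (hT : finGroupType) (H : {group hT}), tower_CDG H n.+2.
Proof.
(* Primes above |G| do not divide it, and s > |G| + r also gives s != r. *)
move=> goodG; have [r lt_G_r r_pr] := prime_above #|G|.
have [s lt_Gr_s s_pr] := prime_above (#|G| + r).
have [kT [G1 [X [Y [K [isoG defK oX oY]]]]]] :=
  tower_CDG_dprod_primes G (prime_gt1 r_pr) (prime_gt1 s_pr).
have [p lt_K_p p_pr] := prime_above #|K|.
have [hT [A [f [injf abelA nAK [a Aa comm_a]]]]] := regular_module_commg K p_pr.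
have oG1 := card_isog isoG.
have [[_ Z _ defZ] _ _ _] := dprodP defK; rewrite defZ in defK.
have [sG1K sZK] : G1 \subset K /\ Z \subset K.
  by have [/normal_sub ? /normal_sub] := dprod_normal2 defK.
have [sXZ sYZ] : X \subset Z /\ Y \subset Z.
  by have [/normal_sub ? /normal_sub] := dprod_normal2 defZ.
have [sXK sYK] := (subset_trans sXZ sZK, subset_trans sYZ sZK).
have coG q : prime q -> #|G| < q -> coprime #|G| q.
  by move=> q_pr ltGq; rewrite coprime_sym prime_coprime // gtnNdvd.
have isoG1 : G \isog f @* G1 := isog_trans isoG (sub_isog sG1K injf).
have [H goodH] : exists H : {group hT}, tower_CDG H n.+2; last by exists hT, H.
apply: (@tower_CDG_extension _ A (f @* G1) (f @* X) (f @* Y) (f @* K) p) => //=.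
- rewrite /pgroup card_injm // p'natE // gtnNdvd //.
- rewrite (injm_dprod sZK injf defZ); exact: injm_dprod injf defK.
- by rewrite card_injm ?oX.
- by rewrite card_injm ?oY.
- rewrite !card_injm // oX oY neq_ltn.
  by rewrite (leq_ltn_trans (leq_addl #|G| r)).
- by rewrite !card_injm // oX -oG1 coG.
- by rewrite !card_injm // oY -oG1 coG // (leq_ltn_trans (leq_addr r #|G|)).
- exists a => // fx fy fz /morphimP[x _ Kx ->] /morphimP[y _ Ky ->].
  case/morphimP=> z _ Kz ->; rewrite -!morphM ?groupM // => ntxyz.
  apply: comm_a => //; apply: contra ntxyz => /(map_f f).
  by rewrite /= morph1.
exact: tower_CDG_isog isoG1 goodG.
Qed.

Lemma tower_CDG_prime (gT : finGroupType) (G : {group gT}) :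
  prime #|G| -> tower_CDG G 1.
Proof.
move=> prG; have abG : abelian G by rewrite cyclic_abelian ?prime_cyclic.
have ntG : G :!=: 1 by rewrite -cardG_gt1 prime_gt1.
split.
- exact: abelian_sol.
- move=> p a p_pr a_gt0; apply/mapP=> [[i _ deg_i]].
  have lin_i : ('chi_i)%R \is a linear_char by apply/char_abelianP.
  move: deg_i; rewrite (lin_char1 lin_i) => /eqP.
  by rewrite Num.Theory.pnatr_eq1 gtn_eqF // -(expn0 p) ltn_exp2l ?prime_gt1.
- split=> [|[|//] _].
    apply: group_inj; rewrite Fitting_series1; apply/eqP.
    by rewrite eqEsubset Fitting_sub Fitting_max ?abelian_nil.
  by move/(congr1 val) => /= G1; rewrite -G1 eqxx in ntG.
- exists G; split=> // N /andP[sNG _] ntN.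
  by rewrite prime_meetG // (setIidPr sNG).
exists [:: #|G|]; apply: (Hall_tower_sdprod (sdprodg1 G) prG _ ntG _ (Hall_tower1 gT)).
  by rewrite /pgroup pnat_id.
exact: pgroup1.
Qed.

(** The ambient type changes at each step, so it is bundled with the group; this also lets one
    choice select both. *)
Lemma tower_CDG_exists n :
  exists GG : {gT : finGroupType & {group gT}}, tower_CDG (projT2 GG) n.+1.
Proof.
elim: n => [|n [[gT G] /= goodG]].
  exists (existT _ _ [set: 'Z_2]%G); apply: tower_CDG_prime.
  by rewrite cardsT card_ord.
by have [hT [H goodH]] := tower_CDG_succ goodG; exists (existT _ hT H).
Qed.

Theorem theorem3p2 :
  (exists (gT : nat -> finGroupType) (G : forall i : nat, {group gT i}),
     forall i : nat, (1 <= i)%N ->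
       [/\ solvable (G i),
           CDG (G i),
           has_Fitting_height (G i) i.+1
         & has_unique_minimal_normal_subgroup (G i)])
  /\
  (exists (gT : nat -> finGroupType) (G : forall i : nat, {group gT i}),
     forall i : nat, (1 <= i)%N ->
       [/\ solvable (G i),
           CDG (G i),
           has_Fitting_height (G i) i.+1,
           has_unique_minimal_normal_subgroup (G i)
         & has_Sylow_tower (G i)]).
Proof.
(* One family serves both claims. *)
suffices [gT [G goodG]] :
    exists (gT : nat -> finGroupType) (G : forall i, {group gT i}),
      forall i, tower_CDG (G i) i.+1.
  split; exists gT, G => i _; have [solG cdgG htG monG [ps towG]] := goodG i.
    by split=> //; apply: monolithic_unique_minimal_normal.
  split=> //; first exact: monolithic_unique_minimal_normal.
  exact: Hall_tower_has_Sylow_tower towG.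
pose GG i := constructive_indefinite_description _ (tower_CDG_exists i).
exists (fun i => projT1 (proj1_sig (GG i))), (fun i => projT2 (proj1_sig (GG i))).
by move=> i; apply: proj2_sig (GG i).
Qed.
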